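(* Let $Q=[0,1]^3$, let $F:Q\to\mathbb R^3$ be a trilinear map, and let $J=\det(DF)$. If $J>0$ on $\partial Q$, then $$\min_{r\in Q}J(r)=\min_{r\in\partial Q}J(r)>0.$$
   Context: Reference coordinates on $Q=[0,1]^3$ are $(x,y,z)$. A map $F:Q\to\mathbb R^3$ is trilinear if it is affine in each of $x,y,z$ separately, i.e. $F(x,y,z)=\sum_{i,j,k\in\{0,1\}}c_{ijk}x^iy^jz^k$ with $c_{ijk}\in\mathbb R^3$. $DF=[\partial F/\partial x\mid\partial F/\partial y\mid\partial F/\partial z]$ is the $3\times3$ Jacobian matrix and $J=\det(DF)$, a polynomial in $(x,y,z)$. $\partial Q$ is the boundary of the cube (the union of its six closed faces). *)

(* Defs.v *)
From mathcomp Require Import all_boot all_order all_algebra.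
From mathcomp Require Import all_classical all_reals all_analysis.

Set Implicit Arguments.
Unset Strict Implicit.
Unset Printing Implicit Defensive.

Import Order.TTheory GRing.Theory Num.Theory.
Import numFieldNormedType.Exports.

Local Open Scope classical_set_scope.
Local Open Scope ring_scope.

(* Points and vectors of R^3 are row vectors 'rV[R]_3; the coordinates (x, y, z)
   of p are (p 0 0, p 0 1, p 0 2). *)

Definition cube (R : realType) : set 'rV[R]_3 :=
  [set p | forall i : 'I_3, 0 <= p 0 i <= 1].

Arguments cube : clear implicits.

Definition cube_boundary (R : realType) : set 'rV[R]_3 :=
  [set p | cube R p /\ exists i : 'I_3, p 0 i = 0 \/ p 0 i = 1].

Arguments cube_boundary : clear implicits.

(* A trilinear map on the cube has exactly one extension to R^3 given by the same
   formula. F stands for that extension, so that its two-sided partial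
   derivatives also make sense at the points of the boundary of the cube. *)
Definition trilinear (R : realType) (F : 'rV[R]_3 -> 'rV[R]_3) : Prop :=
  exists c : 'I_2 -> 'I_2 -> 'I_2 -> 'rV[R]_3,
    forall p : 'rV[R]_3,
      F p = \sum_(i < 2) \sum_(j < 2) \sum_(k < 2)
              (p 0 0 ^+ i * p 0 1 ^+ j * p 0 2 ^+ k) *: c i j k.

(* Column j is the partial derivative of F in the j-th coordinate; this is the
   transpose of the library's [jacobian], which acts on row vectors. *)
Definition DF (R : realType) (F : 'rV[R]_3 -> 'rV[R]_3) (p : 'rV[R]_3) :
    'M[R]_3 :=
  \matrix_(i < 3, j < 3) ('D_(delta_mx 0 j) F p) 0 i.

Definition Jdet (R : realType) (F : 'rV[R]_3 -> 'rV[R]_3) (p : 'rV[R]_3) : R :=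
  \det (DF F p).

(* m is the minimum of f on A, and it is attained. *)
Definition is_minimum (R : realType) (T : Type) (A : set T) (f : T -> R)
    (m : R) : Prop :=
  (f @` A) m /\ lbound (f @` A) m.

(* Main.v *)
(* Write F_x, F_y, F_z for the columns of DF and F_xy, ... for the mixed
   second partial derivatives. The numbers V_x = det(F_y, F_z, F_yz), V_y =
   det(F_z, F_x, F_xz), V_z = det(F_x, F_y, F_xy) depend only on x, y, z
   respectively, and J is quadratic in each variable. By a Pluecker relation,
   the discriminant of J as a quadratic polynomial in x is a square plus 4 V_y
   V_z, and cyclically.

   J > 0 on the cube: suppose J <= 0 at an interior point p. If V_x vanished
   at p, the surface (y, z) |-> F(x, y, z) would be planar and J on that slice
   would be a product of an affine and a bilinear function of (y, z); being
   positive on the boundary of the slice, J would be positive on it. So no V_i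
   vanishes where J <= 0. Among the points of the cube where J <= 0 and all
   V_i have the same signs as at p, take one with x maximal: there J = J_y =
   0, so the discriminant in y is 0 and V_x V_z < 0. Cyclically V_y V_x < 0
   and V_z V_y < 0, but the product of these three numbers is a square.

   At an interior minimum of J all J_i = 0 and J_ii >= 0, so all discriminants
   are <= 0, hence so are the products V_i V_j. By the same square argument
   one of them is 0; the corresponding discriminant is then 0, and J is
   constant on a line parallel to an axis, which meets the boundary. *)

Require Import Defs.
From mathcomp Require Import all_boot all_order all_algebra.
From mathcomp Require Import all_classical all_reals all_analysis.
From mathcomp Require Import ring lra.

Import Order.TTheory GRing.Theory Num.Theory.
Import numFieldNormedType.Exports.

Local Open Scope classical_set_scope.
Local Open Scope ring_scope.

(** * Determinant identities and discriminants along coordinate lines *)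

Definition det3 {R : realType} (u v w : 'rV[R]_3) : R :=
  u 0 0 * (v 0 1 * w 0 2 - v 0 2 * w 0 1)
  - u 0 1 * (v 0 0 * w 0 2 - v 0 2 * w 0 0)
  + u 0 2 * (v 0 0 * w 0 1 - v 0 1 * w 0 0).

(* The Jacobian determinant of the trilinear map whose coefficients are e1, e2,
   e3 at x, y, z, then a at xy, b at yz, c at xz, and d at xyz. *)
Definition tjac {R : realType} (e1 e2 e3 a b c d : 'rV[R]_3) (x y z : R) : R :=
  det3 (e1 + y *: a + z *: c + (y * z) *: d)
       (e2 + z *: b + x *: a + (z * x) *: d)
       (e3 + x *: c + y *: b + (x * y) *: d).

(* V_x; the arguments shifted cyclically give V_y and V_z. *)
Definition tvol {R : realType} (e2 e3 a b c d : 'rV[R]_3) (x : R) : R :=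
  det3 (e2 + x *: a) (e3 + x *: c) (b + x *: d).

(** A cyclic change of coordinates permutes the columns cyclically; this carries results about x
    over to y and z. *)
Lemma tjac_cyclic {R : realType} (e1 e2 e3 a b c d : 'rV[R]_3) (x y z : R) :
  tjac e2 e3 e1 b c a d y z x = tjac e1 e2 e3 a b c d x y z.
Proof. by rewrite /tjac /det3 !mxE; ring. Qed.

(** The left side is the discriminant in t of [det3 u (v0 + t *: v1) (w0 + t *: w1)]; the equality
    is the three-term Pluecker relation for [v0], [v1], [w0], [w1] modulo [u]. *)
Lemma det3_pencil_disc {R : realType} (u v0 v1 w0 w1 : 'rV[R]_3) :
  (det3 u v1 w0 + det3 u v0 w1) ^+ 2 - 4 * det3 u v1 w1 * det3 u v0 w0
  = (det3 u v1 w0 - det3 u v0 w1) ^+ 2 - 4 * (det3 u v0 v1 * det3 u w0 w1).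
Proof. by rewrite /det3; ring. Qed.

Lemma tjac_line {R : realType} (e1 e2 e3 a b c d : 'rV[R]_3) (x y z : R) :
  exists q1 q2,
    (forall t, tjac e1 e2 e3 a b c d (x + t) y z =
               tjac e1 e2 e3 a b c d x y z + q1 * t + q2 * t ^+ 2) /\
    4 * (tvol e3 e1 b c a d y * tvol e1 e2 c a b d z)
      <= q1 ^+ 2 - 4 * q2 * tjac e1 e2 e3 a b c d x y z.
Proof.
pose u := e1 + y *: a + z *: c + (y * z) *: d.
pose v0 := e2 + z *: b + x *: a + (z * x) *: d; pose v1 := a + z *: d.
pose w0 := e3 + x *: c + y *: b + (x * y) *: d; pose w1 := c + y *: d.
exists (det3 u v1 w0 + det3 u v0 w1), (det3 u v1 w1); split=> [t|].
  by rewrite /tjac /u /v0 /v1 /w0 /w1 /det3 !mxE; ring.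
rewrite /tjac -/u -/v0 -/w0 det3_pencil_disc.
(* The multiples of [v1] inside [u] and [v0] drop out, leaving a function of z alone; likewise [w1]
   leaves one of y. *)
have -> : tvol e1 e2 c a b d z = det3 u v0 v1.
  by rewrite /tvol /u /v0 /v1 /det3 !mxE; ring.
have -> : tvol e3 e1 b c a d y = - det3 u w0 w1.
  by rewrite /tvol /u /w0 /w1 /det3 !mxE; ring.
have := sqr_ge0 (det3 u v1 w0 - det3 u v0 w1); lra.
Qed.

(** * Slices on which a volume vanishes *)

Definition dot3 {R : realType} (u v : 'rV[R]_3) : R :=
  u 0 0 * v 0 0 + u 0 1 * v 0 1 + u 0 2 * v 0 2.

(* (u x v) . (w x s), by the Binet-Cauchy identity. *)
Definition crossdot {R : realType} (u v w s : 'rV[R]_3) : R :=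
  dot3 u w * dot3 v s - dot3 u s * dot3 v w.

(** [crossdot v w v w] is the squared norm of v x w, and [det3 u v w] is u . (v x w). *)
Lemma crossdot_gt0 {R : realType} (u v w : 'rV[R]_3) :
  0 < det3 u v w -> 0 < crossdot v w v w.
Proof.
pose n0 := v 0 1 * w 0 2 - v 0 2 * w 0 1.
pose n1 := v 0 0 * w 0 2 - v 0 2 * w 0 0.
pose n2 := v 0 0 * w 0 1 - v 0 1 * w 0 0.
have -> : crossdot v w v w = n0 ^+ 2 + n1 ^+ 2 + n2 ^+ 2.
  by rewrite /crossdot /dot3 /n0 /n1 /n2; ring.
have -> : det3 u v w = u 0 0 * n0 - u 0 1 * n1 + u 0 2 * n2 by [].
move=> det_gt0; rewrite lt_def !addr_ge0 ?sqr_ge0// andbT.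
apply/negP; rewrite !paddr_eq0 ?addr_ge0 ?sqr_ge0// !sqrf_eq0.
case/andP=> /andP[/eqP n00 /eqP n10] /eqP n20.
by move: det_gt0; rewrite n00 n10 n20 !mulr0 subr0 addr0 ltxx.
Qed.

(** For independent [v] and [w], [c] is a combination of them, so (v + z c) x (w + y c) is v x w
    times an affine function of y, z; the factor [crossdot v w v w] clears denominators. *)
Lemma det3_coplanar {R : realType} (u v w c : 'rV[R]_3) (y z : R) :
  det3 v w c = 0 ->
  det3 u (v + z *: c) (w + y *: c) * crossdot v w v w =
  (crossdot v w v w + crossdot v c v w * y + crossdot c w v w * z)
  * det3 u v w.
Proof.
move=> V0; pose q := z *: w - y *: v.
have -> : det3 u (v + z *: c) (w + y *: c) * crossdot v w v w =
    (crossdot v w v w + crossdot v c v w * y + crossdot c w v w * z)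
    * det3 u v w
    + det3 v w c * (dot3 u w * dot3 v q - dot3 u v * dot3 w q).
  by rewrite /q /crossdot /dot3 /det3 !mxE; ring.
by rewrite V0 mul0r addr0.
Qed.

Lemma affine_gt0 {R : realType} (f g t : R) :
  0 < f -> 0 < f + g -> 0 <= t <= 1 -> 0 < f + g * t.
Proof.
move=> f0 fg0 /andP[t0]; rewrite le_eqVlt => /orP[/eqP->|t1].
  by rewrite mulr1.
have : 0 < f * (1 - t) by rewrite mulr_gt0// subr_gt0.
have : 0 <= (f + g) * t by rewrite mulr_ge0// ltW.
lra.
Qed.

Lemma affine_end_gt0 {R : realType} (f g : R) :
  0 < f -> (forall t, 0 <= t <= 1 -> f + g * t != 0) -> 0 < f + g.
Proof.
move=> f0 fg; rewrite ltNge; apply/negP => fg0.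
have g0 : g < 0 by lra.
have t01 : 0 <= f / - g <= 1.
  have ng0 : 0 < - g by rewrite oppr_gt0.
  by rewrite divr_ge0 ?(ltW f0) ?(ltW ng0)//= ler_pdivrMr//; lra.
by have /eqP[] := fg _ t01; field; rewrite lt_eqF.
Qed.

Lemma bilinear_gt0 {R : realType} (g0 g1 g2 g3 y z : R) :
  0 < g0 -> 0 < g0 + g1 -> 0 < g0 + g2 -> 0 < g0 + g1 + g2 + g3 ->
  0 <= y <= 1 -> 0 <= z <= 1 -> 0 < g0 + g1 * y + g2 * z + g3 * (y * z).
Proof.
move=> h0 h1 h2 h3 y01 z01.
have -> : g0 + g1 * y + g2 * z + g3 * (y * z)
        = (g0 + g1 * y) + (g2 + g3 * y) * z by ring.
apply: affine_gt0 => //; first exact: affine_gt0.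
have -> : g0 + g1 * y + (g2 + g3 * y) = g0 + g2 + (g1 + g3) * y by ring.
by apply: affine_gt0 => //; move: h3; lra.
Qed.

Lemma tjac_planar_slice {R : realType} (e1 e2 e3 a b c d : 'rV[R]_3) (x : R) :
  tvol e2 e3 a b c d x = 0 ->
  (forall y z : R, 0 <= y <= 1 -> 0 <= z <= 1 ->
     [|| y == 0, y == 1, z == 0 | z == 1] ->
     0 < tjac e1 e2 e3 a b c d x y z) ->
  forall y z : R, 0 <= y <= 1 -> 0 <= z <= 1 -> 0 < tjac e1 e2 e3 a b c d x y z.
Proof.
rewrite /tvol; set v := e2 + _; set w := e3 + _; set u := b + _ => V0 Jpos.
pose f0 := crossdot v w v w.
pose f1 := crossdot v u v w.
pose f2 := crossdot u w v w.
pose g0 := det3 e1 v w; pose g1 := det3 a v w.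
pose g2 := det3 c v w; pose g3 := det3 d v w.
have Jfg y z : tjac e1 e2 e3 a b c d x y z * f0 =
    (f0 + f1 * y + f2 * z) * (g0 + g1 * y + g2 * z + g3 * (y * z)).
  have -> : tjac e1 e2 e3 a b c d x y z =
      det3 (e1 + y *: a + z *: c + (y * z) *: d) (v + z *: u) (w + y *: u).
    by rewrite /tjac /v /w /u /det3 !mxE; ring.
  rewrite det3_coplanar//; congr (_ * _).
  by rewrite /g0 /g1 /g2 /g3 /det3 !mxE; ring.
have i0 : 0 <= (0 : R) <= 1 by rewrite lexx ler01.
have i1 : 0 <= (1 : R) <= 1 by rewrite lexx ler01.
have f0_gt0 : 0 < f0.
  apply: (@crossdot_gt0 _ e1); have := Jpos 0 0 i0 i0; rewrite eqxx => /(_ isT).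
  rewrite /tjac; congr (0 < det3 _ _ _); apply/rowP => i;
  rewrite /v /w !mxE; ring.
have fg_gt0 (y z : R) : 0 <= y <= 1 -> 0 <= z <= 1 ->
     [|| y == 0, y == 1, z == 0 | z == 1] ->
    0 < (f0 + f1 * y + f2 * z) * (g0 + g1 * y + g2 * z + g3 * (y * z)).
  by move=> *; rewrite -Jfg mulr_gt0// Jpos.
have f_neq0 (y z : R) : 0 <= y <= 1 -> 0 <= z <= 1 ->
    [|| y == 0, y == 1, z == 0 | z == 1] -> f0 + f1 * y + f2 * z != 0.
  move=> hy hz hb; apply/eqP => fyz; have := fg_gt0 _ _ hy hz hb.
  by rewrite fyz mul0r ltxx.
(* The affine factor is positive at (0, 0) and has no zero on the edges, so positivity passes along
   edges to the other corners; the products there then make the bilinear factor positive at all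
   corners. *)
have f10 : 0 < f0 + f1.
  apply: affine_end_gt0 => // t t01; have := f_neq0 t 0 t01 i0.
  by rewrite eqxx !orbT mulr0 addr0; apply.
have f01 : 0 < f0 + f2.
  apply: affine_end_gt0 => // t t01; have := f_neq0 0 t i0 t01.
  by rewrite eqxx mulr0 addr0; apply.
have f11 : 0 < f0 + f1 + f2.
  apply: affine_end_gt0 => // t t01; have := f_neq0 1 t i1 t01.
  by rewrite eqxx orbT mulr1; apply.
have g00 : 0 < g0.
  have := fg_gt0 0 0 i0 i0; rewrite eqxx !mulr0 !addr0 => /(_ isT).
  by rewrite pmulr_rgt0.
have g10 : 0 < g0 + g1.
  have := fg_gt0 1 0 i1 i0; rewrite eqxx !orbT !mulr0 !mulr1 !addr0 => /(_ isT).
  by rewrite pmulr_rgt0.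
have g01 : 0 < g0 + g2.
  have := fg_gt0 0 1 i0 i1.
  rewrite eqxx !mul0r !mulr0 !mulr1 !addr0 => /(_ isT).
  by rewrite pmulr_rgt0.
have g11 : 0 < g0 + g1 + g2 + g3.
  have := fg_gt0 1 1 i1 i1; rewrite eqxx !orbT !mulr1 => /(_ isT).
  by rewrite pmulr_rgt0.
move=> y z hy hz.
rewrite -(pmulr_lgt0 _ f0_gt0) Jfg mulr_gt0 ?bilinear_gt0//.
have := @bilinear_gt0 _ f0 f1 f2 0 y z.
by rewrite mul0r !addr0; apply.
Qed.

(** * Compactness, neighbourhoods and quadratics on lines *)

Lemma cube_compact {R : realType} : compact (cube R).
Proof.
have -> : cube R = [set p | forall i, `[0, 1]%classic (p 0 i)].
  by apply/seteqP; split=> p cp i; have := cp i; rewrite /= in_itv.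
apply: (@rV_compact R 3 (fun=> `[0, 1]%classic)) => i.
exact: segment_compact.
Qed.

Lemma nbhs_line {R : realType} (S : set 'rV[R]_3) (p v : 'rV[R]_3) :
  nbhs p S -> exists2 e : R, 0 < e & forall t, `|t| < e -> S (p + t *: v).
Proof.
move=> pS.
have c0 : (fun t : R => p + t *: v) t @[t --> (0 : R)] --> p.
  rewrite -[X in _ --> X]addr0 -[X in _ + X](scale0r v).
  by apply: cvgD; [exact: cvg_cst|apply: cvgZ; [exact: cvg_id|exact: cvg_cst]].
have /nbhs_norm0P[e /= e0 eS] := c0 _ pS.
by exists e.
Qed.

(** The inequality at t and -t gives |q1| <= q2 t for small t > 0; then t tends to 0. *)
Lemma quadratic_min0 {R : realType} (q1 q2 e : R) :
  0 < e -> (forall t, `|t| < e -> 0 <= q1 * t + q2 * t ^+ 2) ->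
  q1 = 0 /\ 0 <= q2.
Proof.
move=> e0 q_ge0.
have le_q t : 0 < t -> t < e -> `|q1| <= q2 * t.
  move=> t0 te.
  have := q_ge0 t; rewrite gtr0_norm// => /(_ te).
  have := q_ge0 (- t); rewrite normrN gtr0_norm// => /(_ te) h1 h2.
  rewrite -(ler_pM2r t0); have [q10|q10] := ger0P q1; lra.
have e2 : e / 2 < e by lra.
have e2_gt0 : 0 < e / 2 by lra.
have q2_ge0 : 0 <= q2.
  have := le_q _ e2_gt0 e2.
  by move=> /(le_trans (normr_ge0 _)); rewrite pmulr_lge0.
split => //; apply/eqP; rewrite -normr_eq0 eq_le normr_ge0 andbT.
apply/ler_addgt0Pr => h h0; rewrite add0r.
pose t := Num.min (e / 2) (h / (q2 + 1)).
have t0 : 0 < t by rewrite lt_min !divr_gt0// ltr_wpDl.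
have te : t < e by rewrite (le_lt_trans _ e2)// ge_min lexx.
apply: (le_trans (le_q _ t0 te)).
have : (q2 + 1) * t <= h.
  by rewrite mulrC -ler_pdivlMr ?ltr_wpDl// ge_min lexx orbT.
lra.
Qed.

(** Applied with [i], [j], [k] the three axes in some order. Abstracting [J] and [V] lets one
    argument serve all three directions. *)
Definition disc_bound {R : realType} (J : 'rV[R]_3 -> R)
    (V : 'I_3 -> 'rV[R]_3 -> R) (i j k : 'I_3) :=
  forall p, exists q1 q2,
    (forall t, J (p + t *: delta_mx 0 j) = J p + q1 * t + q2 * t ^+ 2) /\
    4 * (V i p * V k p) <= q1 ^+ 2 - 4 * q2 * J p.

Lemma line_coord {R : realType} (p : 'rV[R]_3) (t : R) (j l : 'I_3) :
  (p + t *: delta_mx 0 j) 0 l = p 0 l + t * (l == j)%:R.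
Proof. by rewrite !mxE eqxx. Qed.

Lemma interior_cube {R : realType} (p : 'rV[R]_3) :
  cube R p -> ~ cube_boundary R p -> forall l, 0 < p 0 l < 1.
Proof.
move=> cp bp l; have /andP[p0 p1] := cp l.
rewrite !lt_neqAle p0 p1 !andbT; apply/andP; split; apply/eqP => pl.
  by apply: bp; split=> //; exists l; left.
by apply: bp; split=> //; exists l; right.
Qed.

Lemma near_gt {R : realType} (f : 'rV[R]_3 -> R) (p : 'rV[R]_3) (a : R) :
  continuous f -> a < f p -> \forall q \near p, a < f q.
Proof. by move=> cf; apply: (@cvgr_gt R _ (nbhs p) _ f (f p) (cf p)). Qed.

Lemma near_lt {R : realType} (f : 'rV[R]_3 -> R) (p : 'rV[R]_3) (a : R) :
  continuous f -> f p < a -> \forall q \near p, f q < a.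
Proof. by move=> cf; apply: (@cvgr_lt R _ (nbhs p) _ f (f p) (cf p)). Qed.

Lemma nbhs_interior_cube {R : realType} (p : 'rV[R]_3) :
  (forall l, 0 < p 0 l < 1) -> \forall q \near p, cube R q.
Proof.
move=> ip.
apply: (@filter_forall _ _ (fun l q => 0 <= q 0 l <= 1) (nbhs p) _) => l.
have /andP[p0 p1] := ip l.
have cl := @coord_continuous R 1 3 0 l.
move: (near_gt _ _ _ cl p0) (near_lt _ _ _ cl p1); apply: filterS2 => q q0 q1.
by rewrite !ltW.
Qed.

(** * Signs of the volumes where [J] is nonpositive *)

Lemma nonpos_volume_sign {R : realType} (J : 'rV[R]_3 -> R)
    (V : 'I_3 -> 'rV[R]_3 -> R) (i j k : 'I_3) (p0 : 'rV[R]_3) :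
  i != j -> continuous J -> (forall l, continuous (V l)) ->
  (forall p, cube_boundary R p -> 0 < J p) ->
  (forall p l, cube R p -> J p <= 0 -> V l p != 0) ->
  disc_bound J V i j k ->
  cube R p0 -> J p0 <= 0 -> V i p0 * V k p0 < 0.
Proof.
move=> ij cJ cV Jb Vn0 disc cp0 Jp0.
(* Weak sign conditions make [K] compact; as no [V l] vanishes on [K], they are strict there. *)
pose K := [set p | [/\ cube R p, J p <= 0 &
                       forall l, 0 <= V l p0 * V l p]].
have cVM l : continuous (fun p => V l p0 * V l p).
  by move=> p; apply: continuousM; [exact: cst_continuous|exact: cV].
have K_compact : compact K.
  have -> : K = cube R `&` (J @^-1` [set y | y <= 0] `&`
      \bigcap_(l in [set: 'I_3])
        ((fun p => V l p0 * V l p) @^-1` [set y | 0 <= y])).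
    apply/seteqP; split=> [p [cp Jp Vp]|p [cp [Jp Vp]]].
      by split=> //; split=> // l _; exact: Vp.
    by split=> // l; exact: Vp.
  apply: compact_closedI; first exact: cube_compact.
  apply: closedI.
    have /continuous_closedP := cJ; apply; exact: closed_le.
  apply: closed_bigI => l _; have /continuous_closedP := cVM l; apply.
  exact: closed_ge.
have Kp0 : K p0 by split=> // l; rewrite -expr2 sqr_ge0.
have [p] := @EVT_max_rV R 3 (fun p => p 0 i) K (ex_intro _ _ Kp0) K_compact
  (continuous_subspaceT (@coord_continuous R 1 3 0 i)).
rewrite inE => Kp pmax.
(* [K] avoids the boundary, where J > 0, and strict signs persist: near a point of [K] only J <= 0
   can fail. *)
have nearK q : K q ->
    \forall r \near q, cube R r /\ forall l, 0 <= V l p0 * V l r.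
  move=> [cq Jq Vq].
  have : \forall r \near q, cube R r.
    apply: nbhs_interior_cube; apply: interior_cube => // bq.
    by have := Jb _ bq; rewrite ltNge Jq.
  have : \forall r \near q, forall l, 0 <= V l p0 * V l r.
    apply: (@filter_forall _ _ (fun l r => 0 <= V l p0 * V l r)
      (nbhs q) _) => l.
    have Vl0 : 0 < V l p0 * V l q by rewrite lt_def Vq mulf_neq0 ?Vn0.
    by move: (near_gt _ _ _ (cVM l) Vl0); apply: filterS => r /ltW.
  by apply: filterS2 => r.
(* Otherwise a small move in direction [i] would stay in [K] and exceed the maximum. *)
have Jtop q : K q -> q 0 i = p 0 i -> 0 <= J q.
  move=> Kq qp; rewrite leNgt; apply/negP => Jq.
  have near_neg : \forall r \near q, J r < 0 by exact: near_lt.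
  have near_K : \forall r \near q, K r.
    by move: (nearK _ Kq) near_neg; apply: filterS2 => r [cr Vr] /ltW.
  have [e e0 eK] := @nbhs_line _ _ _ (delta_mx 0 i) near_K.
  have /mem_set/pmax : K (q + (e / 2) *: delta_mx 0 i).
    by apply: eK; rewrite gtr0_norm; lra.
  by rewrite line_coord eqxx mulr1 qp; lra.
have Jp : J p = 0.
  by apply/eqP; rewrite eq_le Jtop// andbT; case: Kp.
have [q1 [q2 [Jline discp]]] := disc p.
have [e e0 eK] := @nbhs_line _ _ _ (delta_mx 0 j) (nearK p Kp).
(* Moves in direction [j] fix coordinate [i], so each point reached has J > 0 or falls under [Jtop]:
   on this line J has a local minimum 0 at [p]. *)
have [q10 _] : q1 = 0 /\ 0 <= q2.
  apply: (quadratic_min0 _ _ _ e0) => t /eK[ct Vt].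
  have -> : q1 * t + q2 * t ^+ 2 = J (p + t *: delta_mx 0 j).
    by rewrite Jline Jp add0r.
  have [Jt|/ltW//] := leP (J (p + t *: delta_mx 0 j)) 0.
  apply: Jtop => //; by rewrite line_coord (negbTE ij) mulr0 addr0.
have {discp}VV_le0 : V i p * V k p <= 0 by move: discp; rewrite q10 Jp; lra.
case: Kp => cp _ Vp.
have V_gt0 l : 0 < V l p0 * V l p by rewrite lt_def Vp mulf_neq0 ?Vn0 ?Jp.
rewrite ltNge; apply/negP => VV0.
have := mulr_ge0_le0 VV0 VV_le0; rewrite mulrACA leNgt.
by rewrite mulr_gt0.
Qed.

(** * Continuity of the determinant and the volumes *)

Lemma continuous_add {T : topologicalType} {R : realType} {V : normedModType R}
    (f g : T -> V) :
  continuous f -> continuous g -> continuous (fun p => f p + g p).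
Proof. by move=> cf cg p; exact: (continuousD (cf p) (cg p)). Qed.

Lemma continuous_sub {T : topologicalType} {R : realType} (f g : T -> R) :
  continuous f -> continuous g -> continuous (fun p => f p - g p).
Proof. by move=> cf cg p; exact: (continuousB (cf p) (cg p)). Qed.

Lemma continuous_mul {T : topologicalType} {R : realType} (f g : T -> R) :
  continuous f -> continuous g -> continuous (fun p => f p * g p).
Proof. by move=> cf cg p; exact: (continuousM (cf p) (cg p)). Qed.

Lemma continuous_scale {T : topologicalType} {R : realType}
    {V : normedModType R} (f : T -> R) (v : V) :
  continuous f -> continuous (fun p => f p *: v).
Proof. by move=> cf p; exact: (continuousZr_tmp (cf p)). Qed.

Lemma continuous_cst {T U : topologicalType} (v : U) :
  continuous (fun _ : T => v).
Proof. by move=> p; exact: cst_continuous. Qed.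

Lemma continuous_coord {R : realType} {T : topologicalType}
    (f : T -> 'rV[R]_3) (l : 'I_3) :
  continuous f -> continuous (fun p => f p 0 l).
Proof.
move=> cf p.
exact: (@continuous_comp _ _ _ f (fun M : 'rV[R]_3 => M 0 l) p (cf p)
  (@coord_continuous R 1 3 0 l (f p))).
Qed.

Lemma det3_continuous {R : realType} (u v w : 'rV[R]_3 -> 'rV[R]_3) :
  continuous u -> continuous v -> continuous w ->
  continuous (fun p => det3 (u p) (v p) (w p)).
Proof.
move=> cu cv cw; rewrite /det3.
have minor k l : continuous (fun p => v p 0 k * w p 0 l - v p 0 l * w p 0 k).
  by apply: continuous_sub; apply: continuous_mul; apply: continuous_coord.
apply: continuous_add; first apply: continuous_sub.
all: by apply: continuous_mul; [apply: continuous_coord|exact: minor].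
Qed.

Lemma tjac_continuous {R : realType} (e1 e2 e3 a b c d : 'rV[R]_3) :
  continuous (fun p : 'rV[R]_3 =>
    tjac e1 e2 e3 a b c d (p 0 0) (p 0 1) (p 0 2)).
Proof.
have column (v v1 v2 v12 : 'rV[R]_3) (k l : 'I_3) : continuous
    (fun p : 'rV[R]_3 =>
      v + p 0 k *: v1 + p 0 l *: v2 + (p 0 k * p 0 l) *: v12).
  have coord := @coord_continuous R 1 3 0.
  apply: continuous_add; [apply: continuous_add; [apply: continuous_add|]|].
  - exact: continuous_cst.
  - by apply: continuous_scale; exact: coord.
  - by apply: continuous_scale; exact: coord.
  - by apply: continuous_scale; apply: continuous_mul; exact: coord.
by apply: det3_continuous; exact: column.
Qed.

Lemma tvol_continuous {R : realType} (e2 e3 a b c d : 'rV[R]_3) (l : 'I_3) :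
  continuous (fun p : 'rV[R]_3 => tvol e2 e3 a b c d (p 0 l)).
Proof.
have edge (v w : 'rV[R]_3) : continuous (fun p : 'rV[R]_3 => v + p 0 l *: w).
  apply: continuous_add; first exact: continuous_cst.
  by apply: continuous_scale; exact: coord_continuous.
by apply: det3_continuous; exact: edge.
Qed.

(** * Location of the minimum *)

Lemma interior_min_line {R : realType} (J : 'rV[R]_3 -> R)
    (V : 'I_3 -> 'rV[R]_3 -> R) (i j k : 'I_3) (r : 'rV[R]_3) :
  disc_bound J V i j k ->
  cube R r -> ~ cube_boundary R r -> 0 < J r ->
  (forall p, cube R p -> J r <= J p) ->
  V i r * V k r < 0 \/ exists2 b, cube_boundary R b & J b = J r.
Proof.
move=> disc cr br Jr rmin.
have [q1 [q2 [Jline discr]]] := disc r.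
have [e e0 eQ] := nbhs_line _ _ (delta_mx 0 j)
  (nbhs_interior_cube _ (interior_cube _ cr br)).
have [q10 q2_ge0] : q1 = 0 /\ 0 <= q2.
  apply: (quadratic_min0 _ _ _ e0) => t /eQ /rmin.
  by rewrite Jline; lra.
have [VV|VV] := ltP (V i r * V k r) 0; [by left|right].
(* The discriminant is -4 q2 J(r), and now it is nonnegative. *)
have q20 : q2 = 0.
  apply/eqP; rewrite eq_le q2_ge0 andbT.
  rewrite -(pmulr_lle0 _ Jr); move: discr; rewrite q10; lra.
(* J is constant on the line; this is its point on the face where coordinate [j] is 0. *)
exists (r + (- r 0 j) *: delta_mx 0 j).
  split; last by exists j; left; rewrite line_coord eqxx mulr1 subrr.
  move=> l; rewrite line_coord; case: eqP => [->|_].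
    by rewrite mulr1 subrr lexx ler01.
  by rewrite mulr0 addr0.
by rewrite Jline q10 q20 !mul0r !addr0.
Qed.

Lemma min_on_boundary {R : realType} (J : 'rV[R]_3 -> R)
    (V : 'I_3 -> 'rV[R]_3 -> R) :
  continuous J -> (forall l, continuous (V l)) ->
  (forall p, cube_boundary R p -> 0 < J p) ->
  (forall p l, cube R p -> J p <= 0 -> V l p != 0) ->
  disc_bound J V 1 0 2 -> disc_bound J V 2 1 0 -> disc_bound J V 0 2 1 ->
  exists m, [/\ is_minimum (cube R) J m, is_minimum (cube_boundary R) J m
    & 0 < m].
Proof.
move=> cJ cV Jb Vn0 disc0 disc1 disc2.
have sign_absurd (s0 s1 s2 : R) :
    s1 * s2 < 0 -> s2 * s0 < 0 -> s0 * s1 < 0 -> False.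
  move=> h0 h1 h2.
  have : (s1 * s2) * (s2 * s0) * (s0 * s1) < 0.
    by rewrite pmulr_rlt0// nmulr_rgt0.
  have -> : (s1 * s2) * (s2 * s0) * (s0 * s1) = (s0 * s1 * s2) ^+ 2 by ring.
  by rewrite ltNge sqr_ge0.
have Jpos p : cube R p -> 0 < J p.
  move=> cp; rewrite ltNge; apply/negP => Jp.
  have VV i j k (ij : i != j) disc :=
    nonpos_volume_sign J V i j k p ij cJ cV Jb Vn0 disc cp Jp.
  by apply: (sign_absurd (V 0 p) (V 1 p) (V 2 p));
    [exact: VV disc0|exact: VV disc1|exact: VV disc2].
have c0 : cube R 0 by move=> l; rewrite mxE lexx ler01.
have [r] := @EVT_min_rV R 3 J (cube R) (ex_intro _ _ c0) cube_compact
  (continuous_subspaceT cJ).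
rewrite inE => cr rmin.
have {}rmin p : cube R p -> J r <= J p by move=> /mem_set/rmin.
have [b bb Jbr] : exists2 b, cube_boundary R b & J b = J r.
  have [br|br] := pselect (cube_boundary R r); first by exists r.
  have [h0|//] := interior_min_line _ _ _ _ _ _ disc0 cr br (Jpos _ cr) rmin.
  have [h1|//] := interior_min_line _ _ _ _ _ _ disc1 cr br (Jpos _ cr) rmin.
  have [h2|//] := interior_min_line _ _ _ _ _ _ disc2 cr br (Jpos _ cr) rmin.
  by case: (sign_absurd _ _ _ h0 h1 h2).
exists (J r); split; last exact: Jpos.
  by split; [exists r|move=> _ [p cp <-]; exact: rmin].
by split; [exists b|move=> _ [p [cp _] <-]; exact: rmin].
Qed.

(** * Reduction of the Jacobian determinant to [tjac] *)

Lemma det_columns {R : realType} (G : 'I_3 -> 'rV[R]_3) :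
  \det (\matrix_(i < 3, j < 3) G j 0 i) = det3 (G 0) (G 1) (G 2).
Proof.
(* Indexing by [nat] lets the lifted ordinals of the expansion and the numerals compute to the same
   terms before [ring]. *)
pose m (i j : nat) := G (inord j) 0 (inord i).
have mE i j : G j 0 i = m i j by rewrite /m !inord_val.
rewrite (expand_det_col _ 0) !big_ord_recl big_ord0 /cofactor.
rewrite !(expand_det_col _ 0) !big_ord_recl !big_ord0 /cofactor !det_mx11 !mxE.
by rewrite /det3 !mE /= /bump /=; ring.
Qed.

Lemma derive_affine_line {R : realType} (F : 'rV[R]_3 -> 'rV[R]_3)
    (p v w : 'rV[R]_3) :
  (forall h, F (p + h *: v) = F p + h *: w) -> 'D_v F p = w.
Proof.
move=> Fline; apply: cvg_lim => //; apply: cvg_near_cst.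
near=> h; rewrite /= [h *: v + p]addrC Fline addrAC subrr add0r scalerA.
rewrite mulVf ?scale1r//.
near: h; exact: nbhs_dnbhs_neq.
Unshelve. all: by end_near. Qed.

Lemma Jdet_trilinear {R : realType} (F : 'rV[R]_3 -> 'rV[R]_3) :
  trilinear F ->
  exists e1 e2 e3 a b c d,
    Jdet F = (fun p => tjac e1 e2 e3 a b c d (p 0 0) (p 0 1) (p 0 2)).
Proof.
move=> [c Fc].
have sum2 (f : 'I_2 -> 'rV[R]_3) : \sum_i f i = f 0 + f 1.
  by rewrite !big_ord_recl big_ord0 addr0; congr (_ + f _); exact: val_inj.
exists (c 1 0 0), (c 0 1 0), (c 0 0 1), (c 1 1 0), (c 0 1 1), (c 1 0 1),
  (c 1 1 1).
apply/funext => p; rewrite /Jdet.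
(* Column [j] is free of coordinate [j], so it is the slope of F along that axis; terms are ordered
   as in [tjac]. *)
pose G (j : 'I_3) : 'rV[R]_3 :=
  if j == 0 then
    c 1 0 0 + p 0 1 *: c 1 1 0 + p 0 2 *: c 1 0 1 + (p 0 1 * p 0 2) *: c 1 1 1
  else if j == 1 then
    c 0 1 0 + p 0 2 *: c 0 1 1 + p 0 0 *: c 1 1 0 + (p 0 2 * p 0 0) *: c 1 1 1
  else
    c 0 0 1 + p 0 0 *: c 1 0 1 + p 0 1 *: c 0 1 1 + (p 0 0 * p 0 1) *: c 1 1 1.
have DG j : 'D_(delta_mx 0 j) F p = G j.
  apply: derive_affine_line => h; rewrite !Fc !sum2 !line_coord.
  apply/rowP => l; rewrite /G; case: j => [[|[|[|//]]] ?] /=;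
  rewrite !mxE /= ?expr0 ?expr1; ring.
have -> : DF F p = \matrix_(i < 3, j < 3) G j 0 i.
  by apply/matrixP => i j; rewrite !mxE DG.
by rewrite det_columns /tjac.
Qed.

Theorem theorem2 (R : realType) (F : 'rV[R]_3 -> 'rV[R]_3) :
  trilinear F ->
  (forall r : 'rV[R]_3, cube_boundary R r -> 0 < Jdet F r) ->
  exists m : R,
    [/\ is_minimum (cube R) (Jdet F) m,
        is_minimum (cube_boundary R) (Jdet F) m
      & 0 < m].
Proof.
move=> /Jdet_trilinear[e1 [e2 [e3 [a [b [c [d ->]]]]]]] /= Jb.
pose V (l : 'I_3) (p : 'rV[R]_3) : R :=
  if l == 0 then tvol e2 e3 a b c d (p 0 0)
  else if l == 1 then tvol e3 e1 b c a d (p 0 1)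
  else tvol e1 e2 c a b d (p 0 2).
apply: (min_on_boundary _ V _ _ Jb).
- exact: tjac_continuous.
- by move=> l; rewrite /V; case: (l == 0); [|case: (l == 1)];
    exact: tvol_continuous.
(* If [V l] vanishes at [p], the slice through [p] normal to axis [l] is planar, whence J(p) > 0. *)
- move=> p l cp; rewrite leNgt; apply: contraNneq => Vl0.
  have Jbd x y z : 0 <= x <= 1 -> 0 <= y <= 1 -> 0 <= z <= 1 ->
      [|| x == 0, x == 1, y == 0, y == 1, z == 0 | z == 1] ->
      0 < tjac e1 e2 e3 a b c d x y z.
    move=> hx hy hz hb.
    pose q : 'rV[R]_3 := \row_j if j == 0 then x else if j == 1 then y else z.
    have := Jb q; rewrite !mxE /=; apply; split.
      by move=> j; rewrite mxE; do 2?case: ifP.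
    case/or4P: hb => [| | |/or3P[]] /eqP h;
      [exists 0|exists 0|exists 1|exists 1|exists 2|exists 2];
      by rewrite mxE /= h; (left + right).
  have [c0 c1 c2] := And3 (cp 0) (cp 1) (cp 2).
  move: Vl0; rewrite /V; case: ifP => _; [|case: ifP => _] => Vl0.
  + apply: (tjac_planar_slice _ _ _ _ _ _ _ _ Vl0) => // y z hy hz hb.
    by apply: Jbd => //; rewrite hb !orbT.
  + rewrite -tjac_cyclic.
    apply: (tjac_planar_slice _ _ _ _ _ _ _ _ Vl0) => // z x hz hx hb.
    rewrite tjac_cyclic; apply: Jbd => //.
    by case/or4P: hb => ->; rewrite ?orbT.
  + rewrite -tjac_cyclic -tjac_cyclic.
    apply: (tjac_planar_slice _ _ _ _ _ _ _ _ Vl0) => // x y hx hy hb.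
    rewrite 2!tjac_cyclic; apply: Jbd => //.
    by case/or4P: hb => ->; rewrite ?orbT.
- move=> p.
  have [q1 [q2 [Jt disc]]] :=
    tjac_line e1 e2 e3 a b c d (p 0 0) (p 0 1) (p 0 2).
  exists q1, q2; split=> // t.
  by rewrite !line_coord /= mulr1 !mulr0 !addr0 Jt.
- move=> p.
  (* Rotate so that y comes first, then rotate back. *)
  have [q1 [q2 [Jt disc]]] :=
    tjac_line e2 e3 e1 b c a d (p 0 1) (p 0 2) (p 0 0).
  rewrite tjac_cyclic in Jt disc.
  exists q1, q2; split=> // t.
  by rewrite !line_coord /= mulr1 !mulr0 !addr0 -Jt -[LHS]tjac_cyclic.
- move=> p.
  have [q1 [q2 [Jt disc]]] :=
    tjac_line e3 e1 e2 c a b d (p 0 2) (p 0 0) (p 0 1).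
  rewrite 2!tjac_cyclic in Jt disc.
  exists q1, q2; split=> // t.
  rewrite !line_coord /= mulr1 !mulr0 !addr0 -Jt.
  by rewrite -[LHS]tjac_cyclic -[LHS]tjac_cyclic.
Qed.
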